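(* Let $(\mathfrak g,[-,-],R)$ be a Rota-Baxter Lie algebra of weight $\lambda$ over $\mathbf k$. If $R$ is idempotent ($R^2=R$), then $$(1+\lambda)R([R(x),y])=(1+\lambda)\big([R(x),R(y)]-\lambda R([x,y])\big)=0,\qquad x,y\in\mathfrak g.$$ In particular, when $\lambda\neq-1$, such an idempotent Rota-Baxter operator $R$ is a Lie algebra homomorphism from $(\mathfrak g,[-,-]_\lambda)$ to $(\mathfrak g,[-,-])$, where $[x,y]_\lambda:=\lambda[x,y]$, with $R(\mathfrak g)$ abelian and $\ker R$ stable under the adjoint action of $R(\mathfrak g)$.
   Context: Convention: $\mathbf k$ is an algebraically closed field of prime characteristic $p$; everything is over $\mathbf k$. A Rota-Baxter Lie algebra of weight $\lambda\in\mathbf k$ is a Lie algebra $(\mathfrak g,[-,-])$ with a linear map $R:\mathfrak g\to\mathfrak g$ such that $[R(x),R(y)]=R([R(x),y])+R([x,R(y)])+\lambda R([x,y])$ for all $x,y\in\mathfrak g$. *)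

(* Defs.v *)
From HB Require Import structures.
From mathcomp Require Import all_boot all_algebra.

Set Implicit Arguments.
Unset Strict Implicit.
Unset Printing Implicit Defensive.

Import GRing.Theory.
Local Open Scope ring_scope.

(* [lie_alt] is [x, x] = 0, the correct axiom also in characteristic 2, where *)
(* antisymmetry alone is weaker. No dimension hypothesis is made.             *)
HB.mixin Record Lmodule_isLie (k : fieldType) g of GRing.Lmodule k g := {
  lie_bracket : g -> g -> g;
  lie_bilinear : bilinear_for *:%R *:%R lie_bracket;
  lie_alt : forall x, lie_bracket x x = 0;
  lie_jacobi : forall x y z,
    lie_bracket x (lie_bracket y z) + lie_bracket y (lie_bracket z x)
      + lie_bracket z (lie_bracket x y) = 0
}.

#[short(type="lieAlgType")]
HB.structure Definition LieAlgebra (k : fieldType) :=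
  {g of GRing.Lmodule k g & Lmodule_isLie k g}.

Notation "[| x , y |]" := (lie_bracket x y)
  (at level 0, x at level 99, y at level 99, format "[| x ,  y |]")
  : ring_scope.

(* The Lie algebra with the same underlying vector space as [g] and bracket   *)
(* [x, y]_lambda = lambda [x, y].                                             *)
Definition scaled_lie (k : fieldType) (lambda : k) (g : lieAlgType k) : Type :=
  g.

Section ScaledLie.
Variables (k : fieldType) (lambda : k) (g : lieAlgType k).

Definition scaled_bracket (x y : g) : g := lambda *: [|x, y|].

Lemma scaled_bilinear : bilinear_for *:%R *:%R scaled_bracket.
Proof.
split=> z a x y; rewrite /scaled_bracket.
  have /= -> := (@lie_bilinear k g).1 z a x y.
  by rewrite scalerDr !scalerA mulrC.
have /= -> := (@lie_bilinear k g).2 z a x y.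
by rewrite scalerDr !scalerA mulrC.
Qed.

Lemma scaled_alt (x : g) : scaled_bracket x x = 0.
Proof. by rewrite /scaled_bracket lie_alt scaler0. Qed.

Lemma lie_bracketZr (a : k) (x y : g) : [|x, a *: y|] = a *: [|x, y|].
Proof.
have H0 : [|x, 0|] = 0.
  have /= := (@lie_bilinear k g).2 x (- 1) 0 0.
  by rewrite scaler0 addr0 scaleN1r addNr.
have /= := (@lie_bilinear k g).2 x a y 0.
by rewrite H0 !addr0.
Qed.

Lemma scaled_jacobi (x y z : g) :
  scaled_bracket x (scaled_bracket y z) + scaled_bracket y (scaled_bracket z x)
    + scaled_bracket z (scaled_bracket x y) = 0.
Proof.
by rewrite /scaled_bracket !lie_bracketZr -!scalerDr lie_jacobi !scaler0.
Qed.

HB.instance Definition _ := GRing.Lmodule.on (scaled_lie lambda g).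
HB.instance Definition _ := Lmodule_isLie.Build k (scaled_lie lambda g)
  scaled_bilinear scaled_alt scaled_jacobi.

End ScaledLie.

Definition lie_morphism (k : fieldType) (g h : lieAlgType k) (f : g -> h) :=
  linear f /\ forall x y, f [|x, y|] = [|f x, f y|].

Definition rota_baxter (k : fieldType) (lambda : k) (g : lieAlgType k)
    (R : g -> g) :=
  forall x y : g,
    [|R x, R y|] = R [|R x, y|] + R [|x, R y|] + lambda *: R [|x, y|].

Definition lin_im (U V : Type) (f : U -> V) : V -> Prop :=
  fun v => exists u, v = f u.

Definition lin_ker (U : Type) (V : nmodType) (f : U -> V) : U -> Prop :=
  fun u => f u = 0.

Section LieSubsets.
Variables (k : fieldType) (g : lieAlgType k).

Definition ad (x : g) : g -> g := fun y => [|x, y|].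

Definition abelian_in (A : g -> Prop) :=
  forall x y, A x -> A y -> [|x, y|] = 0.

Definition ad_stable (A B : g -> Prop) :=
  forall x y, A x -> B y -> B (ad x y).

End LieSubsets.

(* Main.v *)
(** Substituting R x for x in the Rota-Baxter identity and using R^2 = R gives
    (1 + lambda) R[Rx, y] = [Rx, Ry] - R[Rx, Ry]. The right-hand side is killed
    by R and the left-hand side is fixed by it, so both vanish. *)

Require Import Defs.
From mathcomp Require Import all_boot all_algebra.

Import GRing.Theory.
Local Open Scope ring_scope.

Lemma lie_anti (k : fieldType) (g : lieAlgType k) (x y : g) :
  [|x, y|] = - [|y, x|].
Proof.
have addl (u v w : g) : [|u + v, w|] = [|u, w|] + [|v, w|].
  by have /= := (@lie_bilinear k g).1 w 1 u v; rewrite !scale1r.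
have addr (u v w : g) : [|w, u + v|] = [|w, u|] + [|w, v|].
  by have /= := (@lie_bilinear k g).2 w 1 u v; rewrite !scale1r.
have := lie_alt (x + y).
by rewrite addl !addr !lie_alt add0r addr0 => /eqP; rewrite addr_eq0 => /eqP.
Qed.

Section IdempotentRotaBaxter.
Variables (k : fieldType) (lambda : k) (g : lieAlgType k) (R : {linear g -> g}).
Hypotheses (hRB : rota_baxter lambda R) (hidem : idempotent_fun R).

Lemma rota_baxter_idem_scale (x y : g) :
  (1 + lambda) *: R [|R x, y|] = [|R x, R y|] - R [|R x, R y|].
Proof.
have RR z : R (R z) = R z by exact: hidem.
have := hRB (R x) y; rewrite !RR => {1}->.
by rewrite scalerDl scale1r addrAC addrK.
Qed.

Lemma rota_baxter_idem_killl (x y : g) : (1 + lambda) *: R [|R x, y|] = 0.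
Proof.
have RR z : R (R z) = R z by exact: hidem.
have := congr1 R (rota_baxter_idem_scale x y).
by rewrite linearZ linearB /= !RR subrr.
Qed.

Lemma rota_baxter_idem_killr (x y : g) : (1 + lambda) *: R [|x, R y|] = 0.
Proof. by rewrite lie_anti linearN scalerN rota_baxter_idem_killl oppr0. Qed.

Lemma rota_baxter_idem_kill (x y : g) :
  (1 + lambda) *: ([|R x, R y|] - lambda *: R [|x, y|]) = 0.
Proof.
by rewrite hRB addrK scalerDr rota_baxter_idem_killl rota_baxter_idem_killr addr0.
Qed.

End IdempotentRotaBaxter.

Theorem proposition4p3 (k : closedFieldType) (p : nat) (hp : p \in [pchar k])
    (lambda : k) (g : lieAlgType k) (R : {linear g -> g})
    (hRB : rota_baxter lambda R) (hidem : idempotent_fun R) :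
  (forall x y : g,
     (1 + lambda) *: R [|R x, y|]
       = (1 + lambda) *: ([|R x, R y|] - lambda *: R [|x, y|])
     /\ (1 + lambda) *: ([|R x, R y|] - lambda *: R [|x, y|]) = 0)
  /\ (lambda != - 1 ->
      [/\ lie_morphism (R : scaled_lie lambda g -> g),
          abelian_in (lin_im R)
        & ad_stable (lin_im R) (lin_ker R)]).
Proof.
split=> [x y|hl].
  by rewrite rota_baxter_idem_killl // rota_baxter_idem_kill.
have cancel (v : g) : (1 + lambda) *: v = 0 -> v = 0.
  by move/eqP; rewrite scaler_eq0 addrC addr_eq0 (negPf hl) => /eqP.
have kill x y : R [|R x, y|] = 0 by apply/cancel/rota_baxter_idem_killl.
split.
- split=> [a x y|x y]; first exact: linearP.
  have /cancel/eqP := rota_baxter_idem_kill _ _ _ _ hRB hidem x y.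
  by rewrite subr_eq0 => /eqP ->; apply: linearZ.
- move=> _ _ [x ->] [y ->].
  have := rota_baxter_idem_scale _ _ _ _ hRB hidem x y.
  by rewrite !kill scaler0 subr0.
- by move=> _ y [x ->] _; exact: kill.
Qed.
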